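(* Let $\mathbb{K}$ be a field of characteristic zero, $m\ge1$, and let $\mathfrak{d}_{2m+2}=\mathfrak{d}(V_{2m},\varphi,\delta)=\mathbb{K}\cdot\delta\oplus V_{2m}\oplus\mathbb{K}\cdot\delta^*$ be a generalized oscillator $\mathbb{K}$-algebra. Then $\mathfrak{d}_{2m+2}$ is a solvable metric Lie algebra under the invariant bilinear form $$\varphi_\delta(t\delta+u+s\delta^*,\,t'\delta+v+s'\delta^* )=ts'+t's+\varphi(u,v)\qquad (t,t',s,s'\in\mathbb{K},\ u,v\in V_{2m}).$$ The nilradical $\mathfrak{n}(\mathfrak{d}_{2m+2})=[\mathfrak{d}_{2m+2},\mathfrak{d}_{2m+2}]=V_{2m}\oplus\mathbb{K}\cdot\delta^*$ is its only maximal ideal. In particular, $\mathfrak{d}_{2m+2}$ is a local and indecomposable metric algebra, and its centre $$Z(\mathfrak{d}_{2m+2})=\big[[\mathfrak{d}_{2m+2},\mathfrak{d}_{2m+2}],[\mathfrak{d}_{2m+2},\mathfrak{d}_{2m+2}]\big]=\mathbb{K}\cdot\delta^*=Z(\mathfrak{n}(\mathfrak{d}_{2m+2}))$$ is the orthogonal subspace of $\mathfrak{n}(\mathfrak{d}_{2m+2})$ (with respect to $\varphi_\delta$) and the only minimal ideal. Moreover, $\mathfrak{n}(\mathfrak{d}_{2m+2})$ is a Lie algebra of Heisenberg type, in which the product is completely determined by the automorphism $\delta$ through the formulas $[u,v]=\varphi(\delta(u),v)\delta^*$ and $[\delta,u]=\delta(u)$ for all $u,v\in V_{2m}$.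
   Context: Let $(V_{2m},\varphi)$ be a $2m$-dimensional $\mathbb{K}$-vector space with a symmetric nondegenerate bilinear form $\varphi$, and let $\delta$ be a $\varphi$-skew linear automorphism of $V_{2m}$, i.e. a bijective linear map with $\varphi(\delta(u),v)+\varphi(u,\delta(v))=0$ for all $u,v$. The generalized oscillator $\mathbb{K}$-algebra $\mathfrak{d}(V_{2m},\varphi,\delta)$ is the double extension of the abelian metric algebra $(V_{2m},\varphi)$ by $\delta$: the vector space $\mathbb{K}\cdot\delta\oplus V_{2m}\oplus\mathbb{K}\cdot\delta^*$ (with $\delta^*$ the dual $1$-form of $\delta$, viewed as a basis vector) with Lie bracket $$[t\delta+u+s\delta^*,\,t'\delta+v+s'\delta^*]=t\,\delta(v)-t'\,\delta(u)+\varphi(\delta(u),v)\,\delta^*.$$ A Lie algebra is metric if it carries a nondegenerate symmetric bilinear form $\psi$ that is invariant: $\psi([x,y],z)+\psi(y,[x,z])=0$ for all $x,y,z$. A metric Lie algebra is decomposable if it is the orthogonal sum of two (proper nonzero) ideals, and indecomposable otherwise. A Lie algebra is local if it has only one maximal ideal. The nilradical $\mathfrak{n}(\mathfrak{g})$ is the maximal nilpotent ideal of $\mathfrak{g}$, and $Z(\mathfrak{g})$ is the centre. Maximal ideals are maximal among proper ideals, minimal ideals are minimal among nonzero ideals. A Lie algebra of Heisenberg type is a Lie algebra whose centre is one-dimensional and equal to its derived algebra. *)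

(* Defs.v *)
From HB Require Import structures.
From mathcomp Require Import all_boot all_order all_algebra.

Set Implicit Arguments.
Unset Strict Implicit.
Unset Printing Implicit Defensive.

Import GRing.Theory.
Local Open Scope ring_scope.

Section LieAlgebra.
Variables (K : fieldType) (L : vectType K).
Implicit Types (br : L -> L -> L) (psi : L -> L -> K).
Implicit Types (U W I J M N Z : {vspace L}).

Definition is_lie_bracket br : Prop :=
  [/\ bilinear_for *:%R *:%R br,
      (forall x, br x x = 0)
    & forall x y z, br x (br y z) + br y (br z x) + br z (br x y) = 0].

(* The span of all the brackets of an element of U with an element of W. As
   for prodv, brackets of basis elements suffice when br is bilinear. *)
Definition lie_prod br U W : {vspace L} :=
  <<[seq br u w | u <- vbasis U, w <- vbasis W]>>%VS.

Lemma lie_prodP br U W N : bilinear_for *:%R *:%R br ->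
  (lie_prod br U W <= N)%VS <->
  (forall u w, u \in U -> w \in W -> br u w \in N).
Proof.
move=> [brl brr].
have sumL w n (c : 'I_n -> K) (F : 'I_n -> L) :
  br (\sum_i c i *: F i) w = \sum_i c i *: br (F i) w.
  have br0 : br 0 w = 0.
    by have /= := brl w (-1) 0 0; rewrite scaler0 addr0 scaleN1r addNr.
  elim/big_ind2: _ => [|x1 x2 y1 y2 <- <-|i _] //.
    by have /= := brl w 1 x2 y2; rewrite !scale1r.
  by have /= := brl w (c i) (F i) 0; rewrite br0 !addr0.
have sumR u n (c : 'I_n -> K) (F : 'I_n -> L) :
  br u (\sum_i c i *: F i) = \sum_i c i *: br u (F i).
  have br0 : br u 0 = 0.
    by have /= := brr u (-1) 0 0; rewrite scaler0 addr0 scaleN1r addNr.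
  elim/big_ind2: _ => [|x1 x2 y1 y2 <- <-|i _] //.
    by have /= := brr u 1 x2 y2; rewrite !scale1r.
  by have /= := brr u (c i) (F i) 0; rewrite br0 !addr0.
split=> [/span_subvP sN u w uU wW | sN].
  rewrite (coord_vbasis uU) (coord_vbasis wW) sumL memv_suml // => i _.
  rewrite memvZ // sumR memv_suml // => j _; rewrite memvZ // sN //.
  by apply/allpairs_f; rewrite mem_nth // size_tuple.
apply/span_subvP => _ /allpairsP[[u w] [/= uU wW ->]].
by apply: sN; apply: vbasis_mem.
Qed.

Definition is_subalgebra br U : Prop :=
  forall x y, x \in U -> y \in U -> br x y \in U.

Definition is_ideal br I : Prop :=
  forall x y, y \in I -> br x y \in I.

Definition is_maximal_ideal br M : Prop :=
  [/\ is_ideal br M, M <> fullv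
    & forall I, is_ideal br I -> I <> fullv -> (M <= I)%VS -> I = M].

Definition is_minimal_ideal br M : Prop :=
  [/\ is_ideal br M, M <> 0%VS
    & forall I, is_ideal br I -> I <> 0%VS -> (I <= M)%VS -> I = M].

Definition is_solvable br : Prop :=
  exists n, iter n (fun U => lie_prod br U U) fullv = 0%VS.

Definition is_nilpotent_ideal br I : Prop :=
  is_ideal br I /\ exists n, iter n (lie_prod br I) I = 0%VS.

(* The sum of two nilpotent ideals is nilpotent, so in finite dimension the
   maximal nilpotent ideal is the greatest one. *)
Definition is_nilradical br N : Prop :=
  is_nilpotent_ideal br N /\
  forall I, is_nilpotent_ideal br I -> (I <= N)%VS.

(* Z is the centre of the subalgebra U. *)
Definition is_centre br U Z : Prop :=
  forall x, (x \in Z) <-> (x \in U /\ forall y, y \in U -> br x y = 0).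

Definition is_heisenberg_type br U : Prop :=
  is_subalgebra br U /\
  exists Z, [/\ is_centre br U Z, \dim Z = 1%N & Z = lie_prod br U U].

Definition is_local br : Prop := exists! M, is_maximal_ideal br M.

Definition is_invariant br psi : Prop :=
  forall x y z, psi (br x y) z + psi y (br x z) = 0.

Definition is_metric_form br psi : Prop :=
  exists f : {symmetric L},
    [/\ forall x y, f x y = psi x y, nondegenerate f & is_invariant br psi].

Definition is_metric_lie_algebra br psi : Prop :=
  is_lie_bracket br /\ is_metric_form br psi.

Definition is_orthogonal_of psi U W : Prop :=
  forall x, (x \in W) <-> (forall y, y \in U -> psi x y = 0).

Definition is_decomposable br psi : Prop :=
  exists I J, [/\ is_ideal br I /\ is_ideal br J,
    I <> 0%VS /\ I <> fullv, J <> 0%VS /\ J <> fullv,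
    (I + J = fullv)%VS /\ (I :&: J = 0)%VS
  & forall x y, x \in I -> y \in J -> psi x y = 0].

End LieAlgebra.

Section Oscillator.
Variables (K : fieldType) (V : vectType K).
Variables (phi : V -> V -> K) (delta : V -> V).

(* ((t, u), s) stands for t delta + u + s delta^*. *)
Definition osc : vectType K := (K^o * V * K^o)%type.

Definition osc_bracket (x y : osc) : osc :=
  (0, x.1.1 *: delta y.1.2 - y.1.1 *: delta x.1.2, phi (delta x.1.2) y.1.2).

Definition osc_form (x y : osc) : K :=
  x.1.1 * y.2 + y.1.1 * x.2 + phi x.1.2 y.1.2.

Definition osc_d : osc := (1, 0, 0).
Definition osc_in (u : V) : osc := (0, u, 0).
Definition osc_dstar : osc := (0, 0, 1).

(* The subspace V + K delta^*. *)
Definition osc_nil : {vspace osc} :=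
  (limg (linfun osc_in) + <[osc_dstar]>)%VS.

Lemma mem_osc_nil (x : osc) : (x \in osc_nil) = (x.1.1 == 0).
Proof.
have lin : linear osc_in.
  by move=> a u v; rewrite /osc_in; congr (_, _, _); rewrite /= ?scaler0 addr0.
pose lM := GRing.isLinear.Build K V osc _ osc_in lin.
pose F : {linear V -> osc} := HB.pack osc_in lM.
have FE u : linfun osc_in u = osc_in u := lfunE F u.
apply/memv_addP/eqP => [[_ /memv_imgP[u _ ->] [_ /vlineP[k ->] ->]]|x0].
  by rewrite FE /= scaler0 addr0.
exists (osc_in x.1.2); first by rewrite -FE memv_img ?memvf.
exists (x.2 *: osc_dstar); first by rewrite memvZ ?memv_line.
case: x x0 => [[t u] s] /= ->.
by congr (_, _, _); rewrite /= ?scaler0 ?addr0 // add0r [_ *: _]mulr1.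
Qed.

End Oscillator.

(* Main.v *)
From HB Require Import structures.
Require Import Defs.
From mathcomp Require Import all_boot all_order all_algebra.
From mathcomp Require Import ring.

Set Implicit Arguments.
Unset Strict Implicit.
Unset Printing Implicit Defensive.

Import GRing.Theory.
Local Open Scope ring_scope.

(** Write an element of the algebra as t delta + u + s delta^*, and let N be
    the hyperplane t = 0. Everything follows from what an ideal I can contain.

    If I contains an element of N with u <> 0, then bracketing it with a
    suitable w in V gives a nonzero multiple of delta^*, because
    phi (delta u) is a nonzero linear form: delta is injective and phi is
    nondegenerate. If I contains an element x with t <> 0, then [w, x] is
    - t delta w modulo delta^*, which is a nonzero element of N for w <> 0.
    Hence every nonzero ideal contains delta^* ([mem_ideal_dstar]), and
    K delta^* is the only minimal ideal. In the second case the elements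
    [w, x] moreover cover all of V modulo delta^*, since delta is onto, so I
    contains N and x and is the whole algebra ([ideal_not_nil]). Hence every
    proper ideal lies in N, and N is the only maximal ideal. Two proper ideals
    cannot span the algebra, so the algebra is indecomposable.

    On N the bracket is phi (delta u) v delta^* ([nil_bracket]), so the derived
    series of the algebra goes through N and K delta^* to 0, and N is
    nilpotent. An ideal that contains some x with t <> 0 is not nilpotent,
    since ad x acts on V modulo delta^* as the bijection t delta
    ([nilpotent_ideal_sub_nil]); so N is the nilradical.

    Every Lie bracket in which delta^* is central is determined by its values
    on V x V and on delta x V, by bilinearity and antisymmetry
    ([osc_bracket_unique]).

    The bracket is alternating because skewness of delta gives
    2 phi (delta u) u = 0 and 2 is invertible in K. *)

(** * Forms and brackets *)

Lemma nondegenerateP (K : fieldType) (W : vectType K) (f : {symmetric W}) :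
  nondegenerate f <-> (forall u, (forall v, f u v = 0) -> u = 0).
Proof.
split=> [/eqP f0 u fu0|f0].
  by apply/eqP; rewrite -memv0 -f0; apply/mem_orthovP => v _.
apply/eqP/vspaceP => u; rewrite memv0; apply/mem_orthovP/eqP => [fu0 | -> v _].
  by apply: f0 => v; apply: fu0; rewrite memvf.
by rewrite linear0l.
Qed.

Section LieBrackets.
Variables (K : fieldType) (L : vectType K) (br : L -> L -> L).

Lemma mem_lie_prod (U W : {vspace L}) u w :
  bilinear_for *:%R *:%R br -> u \in U -> w \in W -> br u w \in lie_prod br U W.
Proof. by move=> brL; apply: (lie_prodP _ _ _ brL).1. Qed.

Lemma bilinear_bracketE : bilinear_for *:%R *:%R br ->
  [/\ forall x y z, br (x + y) z = br x z + br y z,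
      forall x y z, br x (y + z) = br x y + br x z,
      forall a x y, br (a *: x) y = a *: br x y
    & forall a x y, br x (a *: y) = a *: br x y].
Proof.
move=> brL; pose bM := bilinear_isBilinear.Build K L L L _ _ br brL.
pose b : {bilinear L -> L -> L} := HB.pack br bM.
split=> [x y z|x y z|a x y|a x y].
- exact: (linearDl b).
- exact: (linearDr b).
- exact: (linearZl_LR b).
- exact: (linearZr_LR b).
Qed.

Lemma lie_bracketC : is_lie_bracket br -> forall x y, br x y = - br y x.
Proof.
case=> /bilinear_bracketE[brDl brDr _ _] brxx _ x y; apply/eqP.
by rewrite -addr_eq0 -(brxx (x + y)) brDl !brDr !brxx addr0 add0r.
Qed.

End LieBrackets.

(** * The oscillator algebra and its invariant form *)

Section Oscillator.
Variables (K : fieldType) (V : vectType K).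
Variables (phi : {symmetric V}) (delta : {linear V -> V}).
Hypothesis char_neq2 : 2%:R != 0 :> K.
Hypothesis V_neq0 : (0 < \dim {:V})%N.
Hypothesis phi_nondeg : nondegenerate phi.
Hypothesis delta_bij : bijective delta.
Hypothesis delta_skew : forall u v : V, phi (delta u) v + phi u (delta v) = 0.

Local Notation osc := (osc V).
Local Notation br := (osc_bracket phi delta).
Local Notation psi := (osc_form phi).
Local Notation N := (osc_nil V).
Local Notation Zd := <[osc_dstar V]>%VS.
Implicit Types (x y z : osc) (I : {vspace osc}).

Lemma phiC u v : phi u v = phi v u.
Proof. by rewrite hermC /= expr0 mul1r. Qed.

Lemma phiB a b u v w : phi u (a *: v - b *: w) = a * phi u v - b * phi u w.
Proof. by rewrite linearBr !linearZr_LR. Qed.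

Lemma phi_deltaN u v : phi u (delta v) = - phi (delta u) v.
Proof. by apply/eqP; rewrite -addr_eq0 addrC delta_skew. Qed.

Lemma phi_delta_alt u : phi (delta u) u = 0.
Proof.
have /eqP := delta_skew u u; rewrite (phiC u) -mulr2n -mulr_natl mulf_eq0.
by rewrite (negPf char_neq2) => /eqP.
Qed.

Lemma delta_eq0 u : delta u = 0 -> u = 0.
Proof. by move=> du0; apply: (bij_inj delta_bij); rewrite du0 linear0. Qed.

Lemma phi_delta_neq0 u : u != 0 -> exists v, phi (delta u) v != 0.
Proof.
move=> u0; pose w := delta u; have: w \notin orthov phi fullv.
  rewrite (eqP phi_nondeg) memv0; apply: contraNneq u0 => w0.
  by apply/eqP/delta_eq0.
by case/mem_orthovPn => v _; exists v.
Qed.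

Lemma exists_neq0 : exists u : V, u != 0.
Proof.
exists (vpick {:V}); rewrite vpick0; apply: contraTneq V_neq0 => ->.
by rewrite dimv0.
Qed.

Lemma osc_decomp x :
  x = x.1.1 *: osc_d V + (osc_in x.1.2 + x.2 *: osc_dstar V).
Proof.
case: x => [[t u] s]; congr (_, _, _); rewrite /= ?scaler0 ?add0r ?addr0 //.
  by rewrite [_ *: _]mulr1.
by rewrite [_ *: 1]mulr1.
Qed.

Lemma mem_dstar x : (x \in Zd) = (x.1 == 0).
Proof.
apply/vlineP/eqP => [[k ->]|x0].
  by congr (_, _); rewrite /= scaler0.
exists x.2; case: x x0 => [[t u] s] /= [-> ->].
by congr (_, _, _); rewrite /= ?scaler0 // [_ *: _]mulr1.
Qed.

Lemma osc_bracket_bilinear : bilinear_for *:%R *:%R br.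
Proof.
split=> [y a x1 x2|x a y1 y2]; congr (_, _, _).
- by rewrite /= scaler0 addr0.
- rewrite /= linearP scalerDl scalerBr scalerDr !scalerA (mulrC y.1.1).
  by rewrite opprD addrACA.
- by rewrite /= linearP linearPl.
- by rewrite /= scaler0 addr0.
- rewrite /= linearP scalerDl scalerBr scalerDr !scalerA (mulrC x.1.1).
  by rewrite opprD addrACA.
- by rewrite /= linearPr.
Qed.

Lemma osc_bracket_lie : is_lie_bracket br.
Proof.
split=> [|x|x y z]; first exact: osc_bracket_bilinear.
  by congr (_, _, _); rewrite /= ?subrr ?phi_delta_alt.
congr (_, _, _); rewrite /= ?addr0 //.
  have deltaB a b u v : delta (a *: u - b *: v) = a *: delta u - b *: delta v.
    by rewrite linearB !linearZ.
  rewrite !scale0r !subr0 !deltaB !scalerBr !scalerA.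
  (* The cyclic sum telescopes once the scalars are put in a common order. *)
  rewrite (mulrC y.1.1 x.1.1) (mulrC z.1.1 x.1.1) (mulrC z.1.1 y.1.1).
  by rewrite [X in X + _]addrC subrKA subrKA subrr.
rewrite !phiB (phiC (delta y.1.2) (delta x.1.2)).
rewrite (phiC (delta z.1.2) (delta x.1.2)).
by rewrite (phiC (delta z.1.2) (delta y.1.2)) subrKA subrKA subrr.
Qed.

Lemma osc_form_metric : is_metric_form br psi.
Proof.
have blin : bilinear_for *%R (idfun \; *%R) psi.
  split=> [y a x1 x2|x a y1 y2].
    (* The coordinates are vectors of the regular module of K; both linearity
       claims are polynomial identities once they are read as scalars. *)
    have lin (b c d e p q r s : K) : (a * b + c) * d + e * (a * p + q)
        + (a * r + s) = a * (b * d + e * p + r) + (c * d + e * q + s) by ring.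
    by rewrite /osc_form /= linearPl /= -[RHS]lin.
  have lin (b c d e p q r s : K) : b * (a * p + q) + (a * c + d) * e
      + (a * r + s) = a * (b * p + c * e + r) + (b * q + d * e + s) by ring.
  by rewrite /osc_form /= linearPr /= -[RHS]lin.
have herm x y : psi x y = (-1) ^+ false * idfun (psi y x).
  by rewrite /osc_form /= (phiC x.1.2) expr0 mul1r (addrC (x.1.1 * _)).
pose bM := bilinear_isBilinear.Build K osc osc K _ _ psi blin.
pose hM := isHermitianSesquilinear.Build K osc false idfun psi herm.
pose f : {symmetric osc} := HB.pack (psi : osc -> osc -> K) bM hM.
exists f; split=> //.
  apply/nondegenerateP => -[[t u] s] fx0.
  have /nondegenerateP phi0 := phi_nondeg.
  (* Pairing with delta^* reads off t, pairing with delta reads off s. *)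
  have := fx0 (0, 0, 1); have := fx0 (1, 0, 0).
  rewrite /f /= /osc_form /= !linear0r !mul1r !mul0r !mulr0 !mulr1.
  rewrite !addr0 !add0r => -> ->.
  congr (_, _, _); apply: phi0 => v; have := fx0 (0, v, 0).
  by rewrite /f /= /osc_form /= !mulr0 mul0r !add0r.
move=> x y z; rewrite /osc_form /= (phiC _ z.1.2) !phiB phi_deltaN.
rewrite (phiC z.1.2 (delta x.1.2)) (phiC y.1.2 (delta x.1.2)).
rewrite (phiC y.1.2 (delta z.1.2)).
have cancel (a b c p q r s u : K) :
  0 * s + a * p
     + (b * - q - c * r) + (c * r + 0 * u + (b * q - a * p)) = 0.
  by ring.
exact: cancel.
Qed.

(** * Ideals *)

(** The case t <> 0 reduces to t = 0, because brackets always land in N; the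
    reduction needs some w <> 0 in V. *)
Lemma mem_ideal_dstar I x :
  is_ideal br I -> x \in I -> x != 0 -> osc_dstar V \in I.
Proof.
move=> idI.
have t0 y : y \in I -> y.1.1 = 0 -> y != 0 -> osc_dstar V \in I.
  case: y => [[t u] s] /= yI t0; rewrite {}t0 in yI *.
  have [u0|u0] := eqVneq u 0; last first.
    move=> _; have [w phiw] := phi_delta_neq0 u0.
    have := memvZ (phi (delta w) u)^-1 (idI (osc_in w) _ yI).
    congr (_ \in I); congr (_, _, _); rewrite /= ?scaler0 // ?scale0r ?subrr.
      by rewrite scaler0.
    apply: mulVf; apply: contraNneq phiw => phi0.
    by rewrite -[phi _ _]opprK -phi_deltaN phiC phi0 oppr0.
  rewrite {}u0 in yI *; move=> y0.
  have s0 : s != 0 by apply: contraNneq y0 => ->.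
  have := memvZ (s : K)^-1 yI; congr (_ \in I).
  by congr (_, _, _); rewrite /= ?scaler0 //; apply: mulVf.
move=> xI x0; have [x10|x10] := eqVneq x.1.1 0; first exact: t0 xI x10 x0.
have [w w0] := exists_neq0; apply: t0 (idI (osc_in w) _ xI) _ _ => //.
apply: contraNneq w0 => /(congr1 (fun y => y.1.2)) /= /eqP.
by rewrite scale0r sub0r oppr_eq0 scaler_eq0 (negPf x10) => /eqP/delta_eq0->.
Qed.

(** Any u in V is hit by some [w, x] up to a multiple of delta^*, which is in I
    already; subtracting from x its part in N then leaves t delta. *)
Lemma ideal_not_nil I x : is_ideal br I -> x \in I -> x.1.1 != 0 -> I = fullv.
Proof.
move=> idI xI x0; have dI : osc_dstar V \in I.
  by apply: mem_ideal_dstar xI _ => //; apply: contraNneq x0 => ->.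
have [delta' _ deltaK] := delta_bij.
have inI u : osc_in u \in I.
  (* [w, x] has V-component - t delta w, with t the delta-coordinate of x. *)
  pose w := delta' (- x.1.1^-1 *: u).
  have := memvB (idI (osc_in w) _ xI) (memvZ (phi (delta w) x.1.2) dI).
  congr (_ \in I); congr (_, _, _); rewrite /= ?scaler0 ?subr0 //.
    by rewrite scale0r sub0r deltaK scalerA mulrN divff // scaleN1r opprK.
  by rewrite [_ *: 1]mulr1 subrr.
apply/vspaceP => y; rewrite memvf [y]osc_decomp.
have -> : osc_d V = x.1.1^-1 *: (x - (osc_in x.1.2 + x.2 *: osc_dstar V)).
  by rewrite {2}(osc_decomp x) addrK scalerA mulVf ?scale1r.
by apply: memvD; rewrite ?memvZ // ?memvB ?memvD ?memvZ.
Qed.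

Lemma proper_ideal_sub_nil I : is_ideal br I -> I <> fullv -> (I <= N)%VS.
Proof.
move=> idI nfull; apply/subvP => x xI; rewrite mem_osc_nil.
by apply/negPn/negP => /(ideal_not_nil idI xI).
Qed.

Lemma nil_ideal : is_ideal br N.
Proof. by move=> x y _; rewrite mem_osc_nil. Qed.

Lemma nil_proper : N <> fullv.
Proof.
move=> /vspaceP/(_ (osc_d V)); rewrite memvf mem_osc_nil /= => /eqP/eqP.
exact/negP/oner_neq0.
Qed.

Lemma maximal_idealE M : is_maximal_ideal br M <-> M = N.
Proof.
split=> [[idM pM maxM]|->].
  by rewrite (maxM N nil_ideal nil_proper) //; apply: proper_ideal_sub_nil.
split=> [||I idI pI NI]; [exact: nil_ideal|exact: nil_proper|].
by apply/eqP; rewrite eqEsubv NI proper_ideal_sub_nil.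
Qed.

Lemma osc_indecomposable : ~ is_decomposable br psi.
Proof.
case=> I [J [[idI idJ] [_ pI] [_ pJ] [IJ _] _]]; apply: nil_proper.
by apply/eqP; rewrite eqEsubv subvf -IJ subv_add !proper_ideal_sub_nil.
Qed.

Lemma dstar_ideal : is_ideal br Zd.
Proof.
move=> x y; rewrite !mem_dstar => /eqP y0; apply/eqP.
by rewrite /= y0 /= linear0 scaler0 scale0r subr0.
Qed.

Lemma dstar_neq0 : osc_dstar V != 0.
Proof. by apply/eqP => -[/eqP]; apply/negP/oner_neq0. Qed.

Lemma minimal_idealE I : is_minimal_ideal br I <-> I = Zd.
Proof.
have sub J : is_ideal br J -> J <> 0%VS -> (Zd <= J)%VS.
  move=> idJ J0; rewrite -memvE; apply: mem_ideal_dstar (memv_pick J) _ => //.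
  by rewrite vpick0; apply/eqP.
have Z0 : Zd <> 0%VS.
  move=> /vspaceP/(_ (osc_dstar V)); rewrite memv_line memv0.
  by rewrite (negPf dstar_neq0).
split=> [[idI I0 minI]|->].
  by rewrite -(minI Zd dstar_ideal Z0) //; apply: sub.
split=> // [|J idJ J0 JZ]; first exact: dstar_ideal.
by apply/eqP; rewrite eqEsubv JZ sub.
Qed.

(** * Derived series and nilradical *)

Lemma bracket_osc_d u : br (osc_d V) (osc_in u) = osc_in (delta u).
Proof.
congr (_, _, _); rewrite /=; first by rewrite scale1r scale0r subr0.
by rewrite linear0 linear0l.
Qed.

(** The derived algebra is itself a nonzero ideal, so it contains delta^*; it
    contains V because [delta, u] = delta u and delta is onto. *)
Lemma nil_derived : N = lie_prod br fullv fullv.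
Proof.
have brL := osc_bracket_bilinear.
apply/eqP; rewrite eqEsubv; apply/andP; split; last first.
  by apply/(lie_prodP _ _ _ brL) => u w _ _; rewrite mem_osc_nil.
have mem x y : br x y \in lie_prod br fullv fullv.
  by apply: mem_lie_prod; rewrite ?memvf.
have idD : is_ideal br (lie_prod br fullv fullv) by move=> x y _; apply: mem.
have [w /phi_delta_neq0[v phi0]] := exists_neq0.
have dD : osc_dstar V \in lie_prod br fullv fullv.
  apply: mem_ideal_dstar idD (mem (osc_in w) (osc_in v)) _.
  by apply: contraNneq phi0 => /(congr1 snd) /= ->.
have [delta' _ deltaK] := delta_bij.
apply/subvP => x; rewrite mem_osc_nil => /eqP x0.
rewrite [x]osc_decomp x0 scale0r add0r memvD ?memvZ //.
by rewrite -[x.1.2]deltaK -bracket_osc_d.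
Qed.

Lemma nil_bracket x y :
  x \in N -> y \in N -> br x y = phi (delta x.1.2) y.1.2 *: osc_dstar V.
Proof.
rewrite !mem_osc_nil => /eqP x0 /eqP y0; congr (_, _, _).
- by rewrite /= scaler0.
- by rewrite /= x0 y0 !scale0r subrr scaler0.
- by rewrite /= [_ *: 1]mulr1.
Qed.

Lemma osc_in_nil u : osc_in u \in N. Proof. by rewrite mem_osc_nil. Qed.

Lemma dstar_nil : (Zd <= N)%VS.
Proof. by rewrite -memvE mem_osc_nil. Qed.

Lemma dstar_nil_derived : Zd = lie_prod br N N.
Proof.
have brL := osc_bracket_bilinear.
apply/eqP; rewrite eqEsubv; apply/andP; split; last first.
  apply/(lie_prodP _ _ _ brL) => u w uN wN.
  by rewrite nil_bracket // memvZ ?memv_line.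
rewrite -memvE; have [w /phi_delta_neq0[v phi0]] := exists_neq0.
have := mem_lie_prod brL (osc_in_nil w) (osc_in_nil v).
by rewrite nil_bracket ?osc_in_nil //= rpredZeq (negPf phi0).
Qed.

Lemma bracket_dstar x y : y \in Zd -> br x y = 0.
Proof.
rewrite mem_dstar => /eqP y0.
congr (_, _, _); rewrite /= y0 /= ?linear0r //.
by rewrite linear0 scaler0 scale0r subrr.
Qed.

Lemma lie_prod_dstar U : lie_prod br U Zd = 0%VS.
Proof.
apply/eqP; rewrite -subv0; apply/(lie_prodP _ _ _ osc_bracket_bilinear).
by move=> u w _ wZ; rewrite bracket_dstar // mem0v.
Qed.

Lemma osc_solvable : is_solvable br.
Proof.
by exists 3; rewrite /= -nil_derived -dstar_nil_derived lie_prod_dstar.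
Qed.

Lemma nil_nilpotent : is_nilpotent_ideal br N.
Proof.
split; first exact: nil_ideal.
by exists 2; rewrite /= -dstar_nil_derived lie_prod_dstar.
Qed.

(** If x in I has t <> 0, then I is the whole algebra, so it contains some
    w <> 0 in V; the V-component of (ad x)^k w is t^k delta^k w, never zero,
    although (ad x)^k w lies in the k-th term of the lower central series. *)
Lemma nilpotent_ideal_sub_nil I : is_nilpotent_ideal br I -> (I <= N)%VS.
Proof.
case=> idI [n In0]; apply/subvP => x xI; rewrite mem_osc_nil.
apply/negPn/negP => x0; have [w w0] := exists_neq0.
have brL := osc_bracket_bilinear.
have wI : osc_in w \in I by rewrite (ideal_not_nil idI xI x0) memvf.
pose y k := iter k (br x) (osc_in w).
have yI k : y k \in iter k (lie_prod br I) I.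
  by elim: k => [|k IH] //=; apply: mem_lie_prod.
have y0 k : (y k).1.1 = 0 /\ (y k).1.2 != 0.
  elim: k => [|k [IH1 IH2]] //=; split=> //.
  rewrite IH1 scale0r subr0 scaler_eq0 (negPf x0) /=.
  by apply: contraNneq IH2 => /delta_eq0->.
have := yI n; rewrite In0 memv0 => /eqP yn0.
by have [_] := y0 n; rewrite yn0 eqxx.
Qed.

(** * Centre and orthogonality *)

Lemma nil_centre : is_centre br N Zd.
Proof.
move=> x; split=> [xZ|[xN xC]].
  split=> [|y _]; first exact: subvP dstar_nil x xZ.
  by rewrite (lie_bracketC osc_bracket_lie) bracket_dstar ?oppr0.
rewrite mem_dstar; move: xN; rewrite mem_osc_nil => /eqP x0.
have [u0|/phi_delta_neq0[v /negP[]]] := eqVneq x.1.2 0.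
  by case: x x0 u0 {xC} => [[t u] s] /= -> ->.
by have /(congr1 snd)/= -> := xC _ (osc_in_nil v).
Qed.

(** A central element has t = 0 since t delta w = 0 for some w <> 0; it then
    lies in the centre of N. *)
Lemma osc_centre : is_centre br fullv Zd.
Proof.
move=> x; split=> [xZ|[_ xC]].
  split=> [|y _]; first exact: memvf.
  by rewrite (lie_bracketC osc_bracket_lie) bracket_dstar ?oppr0.
apply/nil_centre; split=> [|y _]; last by apply: xC; apply: memvf.
rewrite mem_osc_nil; have [w w0] := exists_neq0.
have /(congr1 (fun z => z.1.2))/=/eqP := xC (osc_in w) (memvf _).
rewrite scale0r subr0 scaler_eq0 => /orP[//|/eqP/delta_eq0 w00].
by rewrite w00 eqxx in w0.
Qed.

Lemma nil_orthogonal : is_orthogonal_of psi N Zd.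
Proof.
move=> x; rewrite mem_dstar; split=> [/eqP x0 y|xN].
  rewrite mem_osc_nil /osc_form x0 /= => /eqP->.
  by rewrite linear0l !mul0r !addr0.
have := xN (osc_dstar V); rewrite mem_osc_nil eqxx /osc_form /=.
rewrite mulr1 mul0r linear0r !addr0 => /(_ isT) x0.
have /nondegenerateP phi0 := phi_nondeg.
have u0 : x.1.2 = 0.
  apply: phi0 => v; have := xN _ (osc_in_nil v).
  by rewrite /osc_form /= mulr0 mul0r !add0r.
by case: x x0 u0 {xN} => [[t u] s] /= -> ->.
Qed.

Lemma nil_heisenberg : is_heisenberg_type br N.
Proof.
split; first by move=> x y _; apply: nil_ideal.
exists Zd; split; [exact: nil_centre | | exact: dstar_nil_derived].
by rewrite dim_vline dstar_neq0.
Qed.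

(** Both brackets are expanded along the decomposition of their arguments: the
    terms with delta^* vanish, as does the bracket of delta with itself. *)
Lemma osc_bracket_unique br' :
  is_lie_bracket br' ->
  (forall x, br' x (osc_dstar V) = 0) ->
  (forall u v : V,
     br' (osc_in u) (osc_in v) = phi (delta u) v *: osc_dstar V) ->
  (forall u, br' (osc_d V) (osc_in u) = osc_in (delta u)) ->
  forall x y, br' x y = br x y.
Proof.
have expand b : is_lie_bracket b -> (forall x, b x (osc_dstar V) = 0) ->
    forall x y, b x y = x.1.1 *: b (osc_d V) (osc_in y.1.2)
      - y.1.1 *: b (osc_d V) (osc_in x.1.2) + b (osc_in x.1.2) (osc_in y.1.2).
  move=> lieb bx0 x y; have [blin bxx _] := lieb.
  have b0x z : b (osc_dstar V) z = 0 by rewrite (lie_bracketC lieb) bx0 oppr0.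
  have [bDl bDr bZl bZr] := bilinear_bracketE blin.
  rewrite {1}[x]osc_decomp {1}[y]osc_decomp !(bDl, bDr) !(bZl, bZr).
  rewrite !(bxx, bx0, b0x) !scaler0 !(addr0, add0r).
  rewrite (lie_bracketC lieb (osc_in x.1.2) (osc_d V)).
  by rewrite scalerN addrA.
move=> lie' b'0 b'in b'd x y; rewrite (expand br') // (expand br).
- rewrite !b'in !b'd !bracket_osc_d nil_bracket ?osc_in_nil //.
- exact: osc_bracket_lie.
- by move=> z; apply: bracket_dstar; apply: memv_line.
Qed.

End Oscillator.

(** * Structure of the generalized oscillator algebra *)

Theorem proposition3 (K : fieldType) (m : nat) (V : vectType K)
    (phi : {symmetric V}) (delta : {linear V -> V})
    (charK : [pchar K] =i pred0)
    (m_gt0 : (0 < m)%N)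
    (dimV : \dim {:V} = (2 * m)%N)
    (phi_nondeg : nondegenerate phi)
    (delta_bij : bijective delta)
    (delta_skew : forall u v : V, phi (delta u) v + phi u (delta v) = 0) :
  let br : osc V -> osc V -> osc V := osc_bracket phi delta in
  let psi : osc V -> osc V -> K := osc_form phi in
  let N : {vspace osc V} := osc_nil V in
  let Zd : {vspace osc V} := <[osc_dstar V]>%VS in
  (is_metric_lie_algebra br psi /\ is_solvable br) /\
  [/\ is_nilradical br N,
      N = lie_prod br fullv fullv
    & forall M : {vspace osc V}, is_maximal_ideal br M <-> M = N] /\
  (is_local br /\ ~ is_decomposable br psi) /\
  [/\ is_centre br fullv Zd,
      Zd = lie_prod br (lie_prod br fullv fullv) (lie_prod br fullv fullv)
    & is_centre br N Zd] /\
  (is_orthogonal_of psi N Zd /\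
   forall I : {vspace osc V}, is_minimal_ideal br I <-> I = Zd) /\
  is_heisenberg_type br N /\
  [/\ forall u v : V,
        br (osc_in u) (osc_in v) = phi (delta u) v *: osc_dstar V,
      forall u : V, br (osc_d V) (osc_in u) = osc_in (delta u)
    & forall br' : osc V -> osc V -> osc V,
        is_lie_bracket br' ->
        (forall x : osc V, br' x (osc_dstar V) = 0) ->
        (forall u v : V,
           br' (osc_in u) (osc_in v) = phi (delta u) v *: osc_dstar V) ->
        (forall u : V, br' (osc_d V) (osc_in u) = osc_in (delta u)) ->
        forall x y : osc V, br' x y = br x y].
Proof.
have char2 : 2%:R != 0 :> K by have := charK 2; rewrite !inE /= => ->.
have dV : (0 < \dim {:V})%N by rewrite dimV muln_gt0.
move=> br psi N Zd.
have maxE M : is_maximal_ideal br M <-> M = N by apply: maximal_idealE.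
have ND : N = lie_prod br fullv fullv by apply: nil_derived.
split.
  split; last exact: osc_solvable.
  by split; [exact: osc_bracket_lie | exact: osc_form_metric].
split.
  split=> //; split; first exact: nil_nilpotent.
  exact: nilpotent_ideal_sub_nil.
split; first split.
- by exists N; split=> [|M /maxE//]; apply/maxE.
- exact: osc_indecomposable.
split; first split.
- exact: osc_centre.
- by rewrite -ND; apply: dstar_nil_derived.
- exact: nil_centre.
split; first by split; [exact: nil_orthogonal | exact: minimal_idealE].
split; first exact: nil_heisenberg.
split; last exact: osc_bracket_unique.
- by move=> u v; rewrite /br nil_bracket ?osc_in_nil.
- exact: bracket_osc_d.
Qed.
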